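(* Let $y_0\in(-1,1)$, let $s=\{(x,y)\in\mathbb{B}^2:\ y=y_0\}$ be the directrix, and let $\mathcal{F}=(f_0,g_0)\in\mathbb{B}^2$ be the focus, with $g_0\neq y_0$. Put $$\sigma_2=1-\operatorname{sgn}(y_0-g_0)\,y_0,\qquad B=-\frac{2f_0}{\sigma_2},\qquad C=\frac{f_0^2+(y_0-g_0)^2-2|y_0-g_0|}{\sigma_2^2},\qquad E=\frac{2|y_0-g_0|}{\sigma_2},$$ and let $\mathcal{H}\subset\mathbb{R}^2$ be the set of points $(x,y)\in\mathbb{R}^2$ satisfying $$x^2+B\,x\,\overline{y}+C\,\overline{y}^2+E\,\overline{y}=0,\qquad\text{where } \overline{y}=1-\operatorname{sgn}(y_0-g_0)\,y .$$ Then $\mathcal{H}$ is a Euclidean hyperbola, and the Funk's parabola of type 2 with directrix $s$ and focus $\mathcal{F}$, i.e. the set $\{P\in\mathbb{B}^2:\ d_F(P,\mathcal{F})=d_F(P,s)\}$, is the convex curve $$\mathcal{H}\cap\mathbb{B}^2 .$$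
   Context: $\mathbb{B}^2=\{x\in\mathbb{R}^2:\|x\|<1\}$ is the open Euclidean unit disk, with $\langle\cdot,\cdot\rangle$ and $\|\cdot\|$ the usual inner product and norm. $\operatorname{sgn}(t)$ is $1$, $0$, $-1$ for $t>0$, $t=0$, $t<0$ respectively. A convex curve is a plane curve lying on one side of each of its tangent lines. The Funk metric on $\mathbb{B}^2$ is, for $x=(x_1,x_2)\in\mathbb{B}^2$ and $y=(y_1,y_2)\in\mathbb{R}^2$, $$F(x,y)=\sqrt{a_{11}(x)y_1^2+2a_{12}(x)y_1y_2+a_{22}(x)y_2^2}+b_1(x)y_1+b_2(x)y_2,$$ with $b_i=\frac{x_i}{1-x_1^2-x_2^2}$, $a_{11}=\frac{1-x_2^2}{(1-x_1^2-x_2^2)^2}$, $a_{12}=\frac{x_1x_2}{(1-x_1^2-x_2^2)^2}$, $a_{22}=\frac{1-x_1^2}{(1-x_1^2-x_2^2)^2}$. The (non-symmetric) Funk distance $d_F(P,Q)$ from $P$ to $Q$ is the infimum of $\int_a^bF(c(t),c'(t))\,dt$ over piecewise regular curves $c:[a,b]\to\mathbb{B}^2$ with $c(a)=P$, $c(b)=Q$. Explicitly, $d_F(P,P)=0$ and, for $P\ne Q$, $$d_F(P,Q)=\ln\left(\frac{\sqrt{k}-\langle P,Q-P\rangle}{\sqrt{k}-\langle Q,Q-P\rangle}\right),\qquad k=\langle P,Q-P\rangle^2+(1-\|P\|^2)\|Q-P\|^2 .$$ For a line $s\subset\mathbb{B}^2$ and a point $P\in\mathbb{B}^2$, $d_F(P,s)=\inf_{Q\in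 s}d_F(P,Q)$ is the distance from the point to the line. *)

(* Defs.v *)
From Stdlib Require Import Reals.
From Coquelicot Require Import Coquelicot.
Open Scope R_scope.

(* Points and vectors of the Euclidean plane are pairs of reals; subsets of the
   plane are predicates. *)

Definition vsub (P Q : R * R) : R * R := (fst P - fst Q, snd P - snd Q).

Definition det2 (u v : R * R) : R := fst u * snd v - snd u * fst v.

Definition edist (P Q : R * R) : R := dist_euc (fst P) (snd P) (fst Q) (snd Q).

Definition unit_disk (P : R * R) : Prop := edist P (0, 0) < 1.

Definition velocity (c : R -> R * R) (t : R) : R * R :=
  (Derive (fun u => fst (c u)) t, Derive (fun u => snd (c u)) t).

(* Derivatives are two-sided: at an endpoint of [J] that belongs to [J] this asks
   that [c] be the restriction of a curve that is differentiable there, which is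
   no loss of generality since a C^1 curve extends affinely past an endpoint. *)
Definition regular_on (J : R -> Prop) (c : R -> R * R) : Prop :=
  forall t, J t ->
    ex_derive (fun u => fst (c u)) t /\
    ex_derive (fun u => snd (c u)) t /\
    continuous (Derive (fun u => fst (c u))) t /\
    continuous (Derive (fun u => snd (c u))) t /\
    velocity c t <> (0, 0).

Definition regular_piece (c : R -> R * R) (a b : R) : Prop :=
  a < b /\
  exists g : R -> R * R,
    (forall t, a <= t <= b -> g t = c t) /\
    regular_on (fun t => a <= t <= b) g.

(* Continuity of [c] on [a, b] is automatic, because consecutive closed pieces
   share their common endpoint. *)
Inductive piecewise_regular (c : R -> R * R) : R -> R -> Prop :=
| pr_piece a b : regular_piece c a b -> piecewise_regular c a b
| pr_join a m b :
    regular_piece c a m -> piecewise_regular c m b -> piecewise_regular c a b.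

Definition funk_metric (x y : R * R) : R :=
  let (x1, x2) := x in
  let (y1, y2) := y in
  let D := 1 - x1 ^ 2 - x2 ^ 2 in
  let a11 := (1 - x2 ^ 2) / D ^ 2 in
  let a12 := x1 * x2 / D ^ 2 in
  let a22 := (1 - x1 ^ 2) / D ^ 2 in
  let b1 := x1 / D in
  let b2 := x2 / D in
  sqrt (a11 * y1 ^ 2 + 2 * a12 * y1 * y2 + a22 * y2 ^ 2) + b1 * y1 + b2 * y2.

(* At the finitely many break points and at a, b the value of [velocity c] may be
   meaningless; this does not affect the integral. *)
Definition funk_length (c : R -> R * R) (a b : R) : R :=
  RInt (fun t => funk_metric (c t) (velocity c t)) a b.

(* For P, Q in the disk the set of lengths is nonempty and bounded below by 0, so
   the greatest lower bound is finite and [real] only changes its type. *)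
Definition funk_dist (P Q : R * R) : R :=
  real (Glb_Rbar (fun l =>
    exists (c : R -> R * R) (a b : R),
      piecewise_regular c a b /\
      (forall t, a <= t <= b -> unit_disk (c t)) /\
      c a = P /\ c b = Q /\
      l = funk_length c a b)).

Definition funk_dist_to_set (P : R * R) (s : R * R -> Prop) : R :=
  real (Glb_Rbar (fun l => exists Q, s Q /\ l = funk_dist P Q)).

Definition funk_parabola2 (s : R * R -> Prop) (F P : R * R) : Prop :=
  unit_disk P /\ funk_dist P F = funk_dist_to_set P s.

Definition euclidean_hyperbola (H : R * R -> Prop) : Prop :=
  exists (F1 F2 : R * R) (a : R),
    0 < a /\ 2 * a < edist F1 F2 /\
    forall P, H P <-> Rabs (edist P F1 - edist P F2) = 2 * a.

(* [S] is the trace of a regular curve, on a nondegenerate interval [J] of any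
   kind, that lies on one side of each of its tangent lines. *)
Definition convex_curve (S : R * R -> Prop) : Prop :=
  exists (J : R -> Prop) (c : R -> R * R),
    (exists t u, J t /\ J u /\ t < u) /\
    (forall t u v, J t -> J v -> t <= u <= v -> J u) /\
    regular_on J c /\
    (forall P, S P <-> exists t, J t /\ c t = P) /\
    (forall t, J t ->
       (forall P, S P -> 0 <= det2 (velocity c t) (vsub P (c t))) \/
       (forall P, S P -> det2 (velocity c t) (vsub P (c t)) <= 0)).

(* Main.v *)
Require Import Defs.
From Stdlib Require Import Reals Lra.
From Coquelicot Require Import Coquelicot.
Open Scope R_scope.

(** For a unit vector [e], [F (x, y) >= <e, y> / (1 - <e, x>)], with equality when
    [e] is the point where the ray from [x] in the direction [y] leaves the disk.
    Integrating, segments are shortest and [d_F (P, Q) = ln lam], where [lam >= 1]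
    is determined by [|lam Q - P| = lam - 1].  Taking [e = (0, eps)] with
    [eps = 1] or [-1], the distance from [P] to the line [y = y0] is [ln lam] with
    [lam = (1 - eps y) / (1 - eps y0)], so the parabola has the equation
    [|lam F - P| ^ 2 = (lam - 1) ^ 2], which is that of [H].  The conic [H] passes
    through the boundary point [(0, eps)]; projecting from it parametrises the part
    of [H] in the disk rationally over an interval. *)

(** * The unit disk and real-valued infima *)

Lemma unit_disk_iff (P : R * R) : unit_disk P <-> fst P ^ 2 + snd P ^ 2 < 1.
Proof.
unfold unit_disk, edist, dist_euc; simpl fst; simpl snd.
rewrite !Rminus_0_r.
replace (fst P ^ 2 + snd P ^ 2) with (Rsqr (fst P) + Rsqr (snd P)) by (unfold Rsqr; ring).
assert (H : 0 <= Rsqr (fst P) + Rsqr (snd P)) by (unfold Rsqr; nra).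
split; intros L.
- rewrite <- (sqrt_sqrt _ H). pose proof (sqrt_pos (Rsqr (fst P) + Rsqr (snd P))). nra.
- rewrite <- sqrt_1. apply sqrt_lt_1; lra.
Qed.

Lemma real_glb_eq (E : R -> Prop) (d : R) :
  (forall l, E l -> d <= l) ->
  (forall eps, 0 < eps -> exists l, E l /\ l < d + eps) ->
  real (Glb_Rbar E) = d.
Proof.
intros Hlb Happ.
rewrite (is_glb_Rbar_unique E (Finite d)); [reflexivity|].
split.
- intros l Hl; simpl; auto.
- intros [b| |] Hb; simpl; auto.
  + apply Rnot_lt_le; intros Hlt.
    destruct (Happ (b - d)) as [l [El Hl]]; [lra|].
    specialize (Hb l El); simpl in Hb; lra.
  + destruct (Happ 1) as [l [El _]]; [lra|]. exact (Hb l El).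
Qed.

(** * The Funk metric at a point *)

(** With [b = <x, y>] and [k = |y| ^ 2], this exhibits [F] as the larger root of
    [D F ^ 2 - 2 b F - k = 0], the form in which the metric is used from here on. *)
Lemma funk_metric_unfold (x1 x2 y1 y2 : R) :
  x1 ^ 2 + x2 ^ 2 < 1 ->
  (1 - x1 ^ 2 - x2 ^ 2) * funk_metric (x1, x2) (y1, y2)
  = sqrt ((x1 * y1 + x2 * y2) ^ 2 + (1 - x1 ^ 2 - x2 ^ 2) * (y1 ^ 2 + y2 ^ 2))
    + (x1 * y1 + x2 * y2).
Proof.
intros Hx; unfold funk_metric.
set (D := 1 - x1 ^ 2 - x2 ^ 2). assert (HD : 0 < D) by (unfold D; lra).
replace (_ * y1 ^ 2 + _ + _) with
  (((x1 * y1 + x2 * y2) ^ 2 + D * (y1 ^ 2 + y2 ^ 2)) / (D * D)).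
2: { unfold D; field; fold D; lra. }
rewrite sqrt_div_alt by nra. rewrite (sqrt_square D) by lra. field; lra.
Qed.

(* Geometrically, [x + y / F] lies on the unit circle. *)
Lemma funk_metric_eq (x1 x2 y1 y2 : R) :
  x1 ^ 2 + x2 ^ 2 < 1 ->
  let F := funk_metric (x1, x2) (y1, y2) in
  0 <= F /\ (F * x1 + y1) ^ 2 + (F * x2 + y2) ^ 2 = F ^ 2.
Proof.
intros Hx F.
pose proof (funk_metric_unfold x1 x2 y1 y2 Hx) as HF; fold F in HF.
set (D := 1 - x1 ^ 2 - x2 ^ 2) in *. assert (HD : 0 < D) by (unfold D; lra).
set (b := x1 * y1 + x2 * y2) in *. set (k := y1 ^ 2 + y2 ^ 2) in *.
assert (Hk : 0 <= D * k) by (unfold k; nra).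
assert (Hr : 0 <= b ^ 2 + D * k) by nra.
pose proof (sqrt_pos (b ^ 2 + D * k)) as Hs.
pose proof (sqrt_sqrt _ Hr) as Hss.
set (s := sqrt (b ^ 2 + D * k)) in *.
split.
- assert (0 <= s + b) by nra. nra.
- assert (E : D * (D * F ^ 2 - 2 * b * F - k) = 0).
  { replace s with (D * F - b) in Hss by lra. nra. }
  apply Rmult_integral in E; destruct E as [E|E]; [lra|].
  unfold D, b, k in E; lra.
Qed.

(** The roots of [D F ^ 2 - 2 b F - k] have product [- k / D <= 0], so a positive root is the larger
    one. *)
Lemma funk_metric_unique (x1 x2 y1 y2 F : R) :
  x1 ^ 2 + x2 ^ 2 < 1 -> 0 < F ->
  (F * x1 + y1) ^ 2 + (F * x2 + y2) ^ 2 = F ^ 2 ->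
  funk_metric (x1, x2) (y1, y2) = F.
Proof.
intros Hx HF HE.
pose proof (funk_metric_unfold x1 x2 y1 y2 Hx) as HU.
set (D := 1 - x1 ^ 2 - x2 ^ 2) in *. assert (HD : 0 < D) by (unfold D; lra).
set (b := x1 * y1 + x2 * y2) in *. set (k := y1 ^ 2 + y2 ^ 2) in *.
assert (Hk : 0 <= k) by (unfold k; nra).
assert (E : D * F ^ 2 - 2 * b * F - k = 0) by (unfold D, b, k; lra).
assert (Hpos : 0 <= D * F - b).
{ apply Rnot_lt_le; intros Hlt. nra. }
rewrite (sqrt_lem_1 (b ^ 2 + D * k) (D * F - b)) in HU; try nra.
Qed.

Lemma cauchy_schwarz2 (e1 e2 v1 v2 r : R) :
  e1 ^ 2 + e2 ^ 2 <= 1 -> 0 <= r -> v1 ^ 2 + v2 ^ 2 = r ^ 2 ->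
  e1 * v1 + e2 * v2 <= r.
Proof.
intros He Hr Hv.
assert ((e1 * v1 + e2 * v2) ^ 2 <= r ^ 2).
{ pose proof (pow2_ge_0 (e1 * v2 - e2 * v1)).
  assert ((e1 * v1 + e2 * v2) ^ 2 = (e1^2+e2^2) * r^2 - (e1 * v2 - e2 * v1)^2)
    by (rewrite <- Hv; ring).
  pose proof (pow2_ge_0 r). nra. }
apply Rnot_lt_le; intros Hlt; nra.
Qed.

Lemma support_pos (e1 e2 x1 x2 : R) :
  e1 ^ 2 + e2 ^ 2 <= 1 -> x1 ^ 2 + x2 ^ 2 < 1 -> 0 < 1 - (e1 * x1 + e2 * x2).
Proof.
intros He Hx. pose proof (pow2_ge_0 (e1 - x1)). pose proof (pow2_ge_0 (e2 - x2)). nra.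
Qed.

(* Each closed half-plane [<e, _> <= 1] containing the disk gives a lower bound,
   which is the derivative of [- ln (1 - <e, x>)] in the direction [y]. *)
Lemma funk_metric_ge (e1 e2 x1 x2 y1 y2 : R) :
  e1 ^ 2 + e2 ^ 2 <= 1 -> x1 ^ 2 + x2 ^ 2 < 1 ->
  (e1 * y1 + e2 * y2) / (1 - (e1 * x1 + e2 * x2)) <= funk_metric (x1, x2) (y1, y2).
Proof.
intros He Hx.
pose proof (support_pos e1 e2 x1 x2 He Hx) as Hp.
destruct (funk_metric_eq x1 x2 y1 y2 Hx) as [H0 H1].
set (F := funk_metric (x1, x2) (y1, y2)) in *.
pose proof (cauchy_schwarz2 e1 e2 _ _ F He H0 H1) as H.
apply (Rmult_le_reg_r (1 - (e1 * x1 + e2 * x2))); [lra|].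
unfold Rdiv; rewrite Rmult_assoc, Rinv_l by lra. lra.
Qed.

(** A crude bound away from the boundary circle; it serves to make small loops short. *)
Lemma funk_metric_le (x1 x2 y1 y2 r d : R) :
  0 < d <= 1 -> x1 ^ 2 + x2 ^ 2 <= 1 - d -> 0 <= r -> y1 ^ 2 + y2 ^ 2 = r ^ 2 ->
  funk_metric (x1, x2) (y1, y2) <= 3 * r / d.
Proof.
intros Hd Hx Hr Hy.
destruct (funk_metric_eq x1 x2 y1 y2) as [H0 H1]; [lra|].
set (F := funk_metric (x1, x2) (y1, y2)) in *.
assert (Hb : x1 * y1 + x2 * y2 <= r) by (apply cauchy_schwarz2; lra).
apply (Rmult_le_reg_r d); [lra|].
unfold Rdiv; rewrite Rmult_assoc, Rinv_l, Rmult_1_r by lra.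
apply Rnot_lt_le; intros Hlt.
assert (E : (1 - x1 ^ 2 - x2 ^ 2) * F ^ 2 = 2 * F * (x1 * y1 + x2 * y2) + r ^ 2) by lra.
(* Since [d <= 1], [F] would exceed [r]; then [r ^ 2 <= r F], and the quadratic equation gives
   [d F ^ 2 <= 3 r F]. *)
assert (HF : r < F) by nra.
assert (d * F ^ 2 <= (1 - x1 ^ 2 - x2 ^ 2) * F ^ 2)
  by (apply Rmult_le_compat_r; [apply pow2_ge_0|lra]).
assert (F * (x1 * y1 + x2 * y2) <= F * r) by (apply Rmult_le_compat_l; lra).
assert (3 * r * F < F * d * F) by (apply Rmult_lt_compat_r; lra).
nra.
Qed.

Lemma funk_metric_continuous (f1 f2 d1 d2 : R -> R) (t : R) :
  continuous f1 t -> continuous f2 t -> continuous d1 t -> continuous d2 t ->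
  f1 t ^ 2 + f2 t ^ 2 < 1 ->
  continuous (fun u => funk_metric (f1 u, f2 u) (d1 u, d2 u)) t.
Proof.
intros C1 C2 C3 C4 Ht.
apply continuity_pt_filterlim in C1; apply continuity_pt_filterlim in C2.
apply continuity_pt_filterlim in C3; apply continuity_pt_filterlim in C4.
apply continuity_pt_filterlim.
assert (HD : 1 - f1 t * (f1 t * 1) - f2 t * (f2 t * 1) <> 0) by (simpl in Ht; lra).
unfold funk_metric; simpl pow.
pose (cst := fun c : R => continuity_pt_const (fun _ : R => c) t (fun _ _ => eq_refl)).
repeat first
  [ exact C1 | exact C2 | exact C3 | exact C4
  | exact (cst _)
  | match goal with
    | |- continuity_pt (fun u => sqrt _) t =>
       apply (continuity_pt_comp _ sqrt t);
         [|apply continuity_pt_filterlim; apply continuous_sqrt]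
    | |- continuity_pt (fun u => @?f u + @?g u) t => apply (continuity_pt_plus f g t)
    | |- continuity_pt (fun u => @?f u - @?g u) t => apply (continuity_pt_minus f g t)
    | |- continuity_pt (fun u => @?f u / @?g u) t => apply (continuity_pt_div f g t)
    | |- continuity_pt (fun u => @?f u * @?g u) t => apply (continuity_pt_mult f g t)
    end ]; try (exact HD).
all: cbv beta; try (intros E; apply HD; nra).
Qed.

(** * Regular curves and lower bounds for their length *)

Lemma velocity_pair (c1 c2 : R -> R) (t v1 v2 : R) :
  is_derive c1 t v1 -> is_derive c2 t v2 ->
  velocity (fun u => (c1 u, c2 u)) t = (v1, v2).
Proof.
intros H1 H2; unfold velocity; simpl.
f_equal; apply is_derive_unique; assumption.
Qed.

(** The derivative formulas are required near each point because continuity of [Derive] at a point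
    depends on its values around it. *)
Lemma regular_on_pair (J : R -> Prop) (c1 c2 d1 d2 : R -> R) :
  (forall t, J t -> locally t (fun u => is_derive c1 u (d1 u) /\ is_derive c2 u (d2 u))) ->
  (forall t, J t -> continuous d1 t /\ continuous d2 t) ->
  (forall t, J t -> 0 < d1 t ^ 2 + d2 t ^ 2) ->
  regular_on J (fun t => (c1 t, c2 t)).
Proof.
intros Hd Hc Hn t Jt; simpl.
specialize (Hd t Jt); destruct (Hc t Jt) as [C1 C2]; specialize (Hn t Jt).
destruct (locally_singleton _ _ Hd) as [D1 D2].
repeat split.
- now exists (d1 t).
- now exists (d2 t).
- apply (continuous_ext_loc _ d1); [|exact C1].
  revert Hd; apply filter_imp; intros u [H1 H2]; symmetry; now apply is_derive_unique.
- apply (continuous_ext_loc _ d2); [|exact C2].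
  revert Hd; apply filter_imp; intros u [H1 H2]; symmetry; now apply is_derive_unique.
- rewrite (velocity_pair _ _ _ _ _ D1 D2). intros E; injection E as E1 E2.
  rewrite E1, E2 in Hn; lra.
Qed.

(** At an endpoint [c] may have a corner; interior points suffice for integrals. *)
Lemma regular_piece_velocity (c g : R -> R * R) (a b t : R) :
  (forall u, a <= u <= b -> g u = c u) -> a < t < b -> velocity c t = velocity g t.
Proof.
intros Hg Ht.
assert (L : locally t (fun u => c u = g u)).
{ apply (locally_interval _ t a b); simpl; try lra.
  intros u H1 H2; symmetry; apply Hg; lra. }
unfold velocity; f_equal; apply Derive_ext_loc; revert L; apply filter_imp;
  intros u ->; reflexivity.
Qed.

(** The pointwise bound of [funk_metric_ge] is integrated along the curve, with primitive
    [- ln (1 - <e, c t>)]. Integrability is carried along because adding the integrals of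
    consecutive pieces requires it. *)
Lemma regular_piece_length_ge (c : R -> R * R) (a b e1 e2 : R) :
  e1 ^ 2 + e2 ^ 2 <= 1 -> regular_piece c a b ->
  (forall t, a <= t <= b -> unit_disk (c t)) ->
  ex_RInt (fun t => funk_metric (c t) (velocity c t)) a b /\
  ln (1 - (e1 * fst (c a) + e2 * snd (c a))) - ln (1 - (e1 * fst (c b) + e2 * snd (c b)))
    <= funk_length c a b.
Proof.
intros He [Hab [g [Hg Hreg]]] Hdisk.
pose (f1 := fun u => fst (g u)). pose (f2 := fun u => snd (g u)).
assert (HD : forall t, a <= t <= b -> f1 t ^ 2 + f2 t ^ 2 < 1).
{ intros t Ht; unfold f1, f2. rewrite Hg by assumption.
  apply unit_disk_iff; auto. }
assert (Hf : forall t, a <= t <= b ->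
   continuous f1 t /\ continuous f2 t /\
   continuous (Derive f1) t /\ continuous (Derive f2) t).
{ intros t Ht; destruct (Hreg t Ht) as [E1 [E2 [C1 [C2 _]]]].
  repeat split; try assumption; apply @ex_derive_continuous; assumption. }
assert (Heq : forall t, a < t < b ->
   funk_metric (f1 t, f2 t) (Derive f1 t, Derive f2 t) = funk_metric (c t) (velocity c t)).
{ intros t Ht. rewrite (regular_piece_velocity c g a b t Hg Ht).
  unfold f1, f2. rewrite <- surjective_pairing, Hg by lra. reflexivity. }
assert (Hint : ex_RInt (fun t => funk_metric (f1 t, f2 t) (Derive f1 t, Derive f2 t)) a b).
{ apply (ex_RInt_continuous (V := R_CompleteNormedModule)); intros t Ht.
  rewrite Rmin_left, Rmax_right in Ht by lra.
  destruct (Hf t Ht) as [? [? [? ?]]]. apply funk_metric_continuous; auto. }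
split.
{ revert Hint; apply ex_RInt_ext; intros t Ht.
  rewrite Rmin_left, Rmax_right in Ht by lra. auto. }
unfold funk_length.
rewrite <- (RInt_ext (V := R_CompleteNormedModule)
   (fun t => funk_metric (f1 t, f2 t) (Derive f1 t, Derive f2 t))).
2: { intros t Ht. rewrite Rmin_left, Rmax_right in Ht by lra. auto. }
assert (HS : forall t, a <= t <= b -> 0 < 1 - (e1 * f1 t + e2 * f2 t))
  by (intros; apply support_pos; auto).
pose (h := fun t => - ln (1 - (e1 * f1 t + e2 * f2 t))).
pose (dh := fun t => (e1 * Derive f1 t + e2 * Derive f2 t) / (1 - (e1 * f1 t + e2 * f2 t))).
assert (Hh : is_RInt dh a b (minus (h b) (h a))).
{ apply (is_RInt_derive (V := R_CompleteNormedModule));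
    intros t Ht; rewrite Rmin_left, Rmax_right in Ht by lra.
  - destruct (Hreg t Ht) as [E1 [E2 _]]. specialize (HS t Ht).
    unfold h, dh. fold f1 in E1; fold f2 in E2.
    auto_derive; [repeat split; auto; lra|].
    replace (Derive (fun x : R => f1 x)) with (Derive f1) by reflexivity.
    replace (Derive (fun x : R => f2 x)) with (Derive f2) by reflexivity.
    field; lra.
  - destruct (Hf t Ht) as [C1 [C2 [C3 C4]]]. specialize (HS t Ht).
    unfold dh.
    apply (continuous_mult (K := R_AbsRing)).
    + apply (continuous_plus (V := R_NormedModule));
        apply (continuous_mult (K := R_AbsRing)); auto using continuous_const.
    + apply (continuous_Rinv_comp (fun t => 1 - (e1 * f1 t + e2 * f2 t))); [|lra].
      apply (continuous_minus (V := R_NormedModule)); [apply continuous_const|].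
      apply (continuous_plus (V := R_NormedModule));
        apply (continuous_mult (K := R_AbsRing)); auto using continuous_const. }
pose proof (is_RInt_le _ _ a b _ _ (Rlt_le _ _ Hab) Hh (RInt_correct _ _ _ Hint)) as HL.
unfold minus, plus, opp, h in HL; simpl in HL.
rewrite <- !Hg by lra. fold (f1 a) (f2 a) (f1 b) (f2 b).
assert (HL' : ln (1 - (e1 * f1 a + e2 * f2 a)) - ln (1 - (e1 * f1 b + e2 * f2 b)) =
  - ln (1 - (e1 * f1 b + e2 * f2 b)) + - - ln (1 - (e1 * f1 a + e2 * f2 a))) by ring.
rewrite HL'. apply HL.
intros t Ht. apply funk_metric_ge; auto. apply HD; lra.
Qed.

Lemma piecewise_regular_lt (c : R -> R * R) (a b : R) : piecewise_regular c a b -> a < b.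
Proof.
induction 1 as [a b [H _]|a m b [H _] _ IH]; lra.
Qed.

Lemma piecewise_regular_length_ge (c : R -> R * R) (a b e1 e2 : R) :
  e1 ^ 2 + e2 ^ 2 <= 1 -> piecewise_regular c a b ->
  (forall t, a <= t <= b -> unit_disk (c t)) ->
  ex_RInt (fun t => funk_metric (c t) (velocity c t)) a b /\
  ln (1 - (e1 * fst (c a) + e2 * snd (c a))) - ln (1 - (e1 * fst (c b) + e2 * snd (c b)))
    <= funk_length c a b.
Proof.
intros He Hc; induction Hc as [a b Hp|a m b Hp Hc IH]; intros Hdisk.
- apply regular_piece_length_ge; assumption.
- pose proof (piecewise_regular_lt _ _ _ Hc) as Hmb.
  pose proof (proj1 Hp) as Ham.
  destruct (regular_piece_length_ge c a m e1 e2 He Hp) as [I1 L1];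
    [intros t Ht; apply Hdisk; lra|].
  destruct IH as [I2 L2]; [intros t Ht; apply Hdisk; lra|].
  split; [exact (ex_RInt_Chasles _ _ _ _ I1 I2)|].
  unfold funk_length in *.
  rewrite <- (RInt_Chasles _ _ _ _ I1 I2). unfold plus; simpl; lra.
Qed.

(** * Segments, small loops and the distance between two points *)

Lemma sum_sqr_div (u v l : R) : l <> 0 -> (u / l) ^ 2 + (v / l) ^ 2 = (u ^ 2 + v ^ 2) / l ^ 2.
Proof. intros; field; assumption. Qed.

Lemma sum_sqr_le0 (u v : R) : u ^ 2 + v ^ 2 <= 0 -> u = 0 /\ v = 0.
Proof.
intros H; rewrite <- !Rsqr_pow2 in H. apply Rplus_sqr_eq_0.
pose proof (Rle_0_sqr u). pose proof (Rle_0_sqr v). lra.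
Qed.

(** The unit vector [e = (lam Q - P) / (lam - 1)] is where the ray from [P] through [Q] leaves the
    disk. At time [t] it is reached by adding [w = lam / (lam - 1) - t] times [Q - P], so the metric
    along the segment is [/ w]. *)
Lemma segment_length (P Q : R * R) (lam : R) :
  unit_disk P -> unit_disk Q -> 1 < lam ->
  (lam * fst Q - fst P) ^ 2 + (lam * snd Q - snd P) ^ 2 = (lam - 1) ^ 2 ->
  exists c a b, piecewise_regular c a b /\
    (forall t, a <= t <= b -> unit_disk (c t)) /\ c a = P /\ c b = Q /\
    ln lam = funk_length c a b.
Proof.
destruct P as [p1 p2], Q as [q1 q2]; rewrite !unit_disk_iff; simpl fst; simpl snd.
intros HP HQ Hl HE.
pose (c1 := fun t : R => p1 + t * (q1 - p1)). pose (c2 := fun t : R => p2 + t * (q2 - p2)).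
assert (D1 : forall t, is_derive c1 t (q1 - p1))
  by (intros; unfold c1; auto_derive; trivial; ring).
assert (D2 : forall t, is_derive c2 t (q2 - p2))
  by (intros; unfold c2; auto_derive; trivial; ring).
assert (HD : forall t, 0 <= t <= 1 -> c1 t ^ 2 + c2 t ^ 2 < 1).
{ intros t Ht; unfold c1, c2.
  assert (Hconv : (p1 + t * (q1 - p1)) ^ 2 + (p2 + t * (q2 - p2)) ^ 2 =
    (1 - t) * (p1 ^ 2 + p2 ^ 2) + t * (q1 ^ 2 + q2 ^ 2)
      - t * (1 - t) * ((q1 - p1) ^ 2 + (q2 - p2) ^ 2)) by ring.
  rewrite Hconv.
  assert (0 <= t * (1 - t) * ((q1 - p1) ^ 2 + (q2 - p2) ^ 2)).
  { repeat apply Rmult_le_pos; try lra.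
    pose proof (pow2_ge_0 (q1 - p1)). pose proof (pow2_ge_0 (q2 - p2)). lra. }
  destruct (Rle_lt_dec t (1 / 2)); nra. }
exists (fun t => (c1 t, c2 t)), 0, 1.
assert (HF : forall t, 0 <= t <= 1 ->
  funk_metric (c1 t, c2 t) (velocity (fun u => (c1 u, c2 u)) t) = / (lam / (lam - 1) - t)).
{ intros t Ht. rewrite (velocity_pair c1 c2 t _ _ (D1 t) (D2 t)).
  assert (Hpos : 0 < lam / (lam - 1) - t).
  { replace (lam / (lam - 1) - t) with ((1 - t) + / (lam - 1)) by (field; lra).
    pose proof (Rinv_0_lt_compat (lam - 1)); lra. }
  apply funk_metric_unique; [auto|apply Rinv_0_lt_compat; lra|].
  set (w := lam / (lam - 1) - t) in *.
  assert (Hb : (c1 t + w * (q1 - p1)) ^ 2 + (c2 t + w * (q2 - p2)) ^ 2 = 1).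
  { unfold c1, c2, w.
    replace (p1 + t * (q1 - p1) + (lam / (lam - 1) - t) * (q1 - p1))
      with ((lam * q1 - p1) / (lam - 1)) by (field; lra).
    replace (p2 + t * (q2 - p2) + (lam / (lam - 1) - t) * (q2 - p2))
      with ((lam * q2 - p2) / (lam - 1)) by (field; lra).
    rewrite sum_sqr_div, HE by lra. field; lra. }
  replace (/ w * c1 t + (q1 - p1)) with (/ w * (c1 t + w * (q1 - p1))) by (field; lra).
  replace (/ w * c2 t + (q2 - p2)) with (/ w * (c2 t + w * (q2 - p2))) by (field; lra).
  rewrite !Rpow_mult_distr, <- Rmult_plus_distr_l, Hb. ring. }
split; [|split; [|split; [|split]]].
- apply pr_piece. split; [lra|].
  exists (fun t => (c1 t, c2 t)). split; [reflexivity|].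
  apply (regular_on_pair _ _ _ (fun _ => q1 - p1) (fun _ => q2 - p2)).
  + intros t _; apply filter_forall; auto.
  + intros t _; split; apply continuous_const.
  + intros t _. apply Rnot_le_lt; intros Hle.
    destruct (sum_sqr_le0 _ _ Hle) as [E1 E2].
    apply Rminus_diag_uniq in E1; apply Rminus_diag_uniq in E2; subst.
    (* If [P = Q], the equation would put [P] on the unit circle. *)
    assert ((lam - 1) ^ 2 * (p1 ^ 2 + p2 ^ 2) = (lam - 1) ^ 2) by (rewrite <- HE at 2; ring).
    assert (0 < (lam - 1) ^ 2) by (apply pow_lt; lra). nra.
- intros t Ht; apply unit_disk_iff; exact (HD t Ht).
- unfold c1, c2; cbv beta; f_equal; ring.
- unfold c1, c2; cbv beta; f_equal; ring.
- unfold funk_length; symmetry; apply is_RInt_unique.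
  apply (is_RInt_ext (fun t => / (lam / (lam - 1) - t))).
  { intros t Ht. rewrite Rmin_left, Rmax_right in Ht by lra. symmetry; apply HF; lra. }
  assert (Hpos : forall t, 0 <= t <= 1 -> 0 < lam / (lam - 1) - t).
  { intros t Ht.
    replace (lam / (lam - 1) - t) with ((1 - t) + / (lam - 1)) by (field; lra).
    pose proof (Rinv_0_lt_compat (lam - 1)); lra. }
  pose (h := fun t => - ln (lam / (lam - 1) - t)).
  replace (ln lam) with (minus (h 1) (h 0)).
  + apply (is_RInt_derive (V := R_CompleteNormedModule));
      intros t Ht; rewrite Rmin_left, Rmax_right in Ht by lra; specialize (Hpos t Ht).
    * set (w := lam / (lam - 1)) in *; unfold h; auto_derive; [lra|field; lra].
    * apply (continuous_Rinv_comp (fun t => lam / (lam - 1) - t)); [|lra].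
      apply (continuous_minus (V := R_NormedModule)); [apply continuous_const|apply continuous_id].
  + unfold minus, plus, opp, h; simpl.
    replace (lam / (lam - 1) - 1) with (/ (lam - 1)) by (field; lra).
    rewrite Rminus_0_r, ln_Rinv by lra. unfold Rdiv.
    rewrite ln_mult, ln_Rinv by (try apply Rinv_0_lt_compat; lra). ring.
Qed.

(** A constant curve is not regular, so [d_F (P, P) = 0] is approached through small circles passing
    through [P]. *)
Lemma short_loop (P : R * R) (eps : R) :
  unit_disk P -> 0 < eps ->
  exists c a b, piecewise_regular c a b /\
    (forall t, a <= t <= b -> unit_disk (c t)) /\ c a = P /\ c b = P /\
    funk_length c a b < eps.
Proof.
destruct P as [p1 p2]; rewrite unit_disk_iff; simpl fst; simpl snd; intros HP Heps.
pose (d := (1 - (p1 ^ 2 + p2 ^ 2)) / 2).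
assert (Hd : 0 < d <= 1) by (unfold d; nra).
assert (HPI := PI_RGT_0).
(* The first bound keeps the circle where [|x| ^ 2 <= 1 - d]; the second makes the length estimate
   [2 PI * (3 r / d)] at most [eps / 2]. *)
pose (r := Rmin (d / 9) (eps * d / (12 * PI))).
assert (Hr : 0 < r).
{ apply Rmin_glb_lt; [lra|]. apply Rdiv_lt_0_compat; nra. }
assert (Hr1 : r <= d / 9) by apply Rmin_l.
assert (Hr2 : r <= eps * d / (12 * PI)) by apply Rmin_r.
pose (c1 := fun t : R => p1 + r * (cos t - 1)). pose (c2 := fun t : R => p2 + r * sin t).
assert (D1 : forall t, is_derive c1 t (- r * sin t))
  by (intros; unfold c1; auto_derive; trivial; ring).
assert (D2 : forall t, is_derive c2 t (r * cos t))
  by (intros; unfold c2; auto_derive; trivial; ring).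
assert (HD : forall t, c1 t ^ 2 + c2 t ^ 2 <= 1 - d).
{ intros t; unfold c1, c2.
  pose proof (sin2_cos2 t) as Hsc; unfold Rsqr in Hsc.
  pose proof (COS_bound t) as Hcb. set (C := cos t) in *; set (S := sin t) in *.
  assert (Hip : p1 * (C - 1) + p2 * S <= 5 / 2).
  { pose proof (pow2_ge_0 (p1 - (C - 1))). pose proof (pow2_ge_0 (p2 - S)). nra. }
  assert (Hx : (p1 + r * (C - 1)) ^ 2 + (p2 + r * S) ^ 2 =
    p1 ^ 2 + p2 ^ 2 + 2 * r * (p1 * (C - 1) + p2 * S) + r ^ 2 * (2 - 2 * C)
    + r ^ 2 * (S * S + C * C - 1)) by ring.
  rewrite Hx, Hsc. unfold d in *. nra. }
assert (Hreg : regular_piece (fun t => (c1 t, c2 t)) 0 (2 * PI)).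
{ split; [lra|]. exists (fun t => (c1 t, c2 t)). split; [reflexivity|].
  apply (regular_on_pair _ _ _ (fun t => - r * sin t) (fun t => r * cos t)).
  + intros t _; apply filter_forall; auto.
  + intros t _; split; apply (@ex_derive_continuous R_AbsRing R_NormedModule); auto_derive; trivial.
  + intros t _. pose proof (sin2_cos2 t) as Hsc; unfold Rsqr in Hsc. nra. }
assert (Hdisk : forall t, 0 <= t <= 2 * PI -> unit_disk (c1 t, c2 t)).
{ intros t _; apply unit_disk_iff; simpl fst; simpl snd; specialize (HD t); lra. }
exists (fun t => (c1 t, c2 t)), 0, (2 * PI).
split; [|split; [|split; [|split]]].
- now apply pr_piece.
- exact Hdisk.
- unfold c1, c2. rewrite cos_0, sin_0. cbv beta; f_equal; ring.
- unfold c1, c2. rewrite cos_2PI, sin_2PI. cbv beta; f_equal; ring.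
(* Only integrability is taken from this instance with [e = 0]. *)
- destruct (regular_piece_length_ge _ 0 (2 * PI) 0 0 ltac:(lra) Hreg Hdisk) as [Hint _].
  assert (Hle : funk_length (fun t => (c1 t, c2 t)) 0 (2 * PI)
      <= RInt (fun _ => 3 * r / d) 0 (2 * PI)).
  { apply RInt_le; [lra|exact Hint|apply ex_RInt_const|].
    intros t _. rewrite (velocity_pair c1 c2 t _ _ (D1 t) (D2 t)).
    apply funk_metric_le; auto; [lra|].
    pose proof (sin2_cos2 t) as Hsc; unfold Rsqr in Hsc.
    replace ((- r * sin t) ^ 2 + (r * cos t) ^ 2)
      with (r ^ 2 * (sin t * sin t + cos t * cos t)) by ring.
    rewrite Hsc; ring. }
  rewrite RInt_const in Hle. unfold scal in Hle; simpl in Hle; unfold mult in Hle; simpl in Hle.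
  apply (Rle_lt_trans _ _ _ Hle).
  assert (Hlim : (2 * PI - 0) * (3 * (eps * d / (12 * PI)) / d) = eps / 2) by (field; lra).
  apply (Rle_lt_trans _ (eps / 2)); [|lra].
  rewrite <- Hlim. apply Rmult_le_compat_l; [lra|].
  unfold Rdiv at 1 3. apply Rmult_le_compat_r; [apply Rlt_le, Rinv_0_lt_compat; lra|lra].
Qed.

(* [lam = exp d] is characterised by [Q] lying on the circle of centre [P / lam]
   and radius [1 - 1 / lam]: these are the forward Funk circles about [P]. *)
Lemma funk_dist_eq (P Q : R * R) (lam : R) :
  unit_disk P -> unit_disk Q -> 1 <= lam ->
  (lam * fst Q - fst P) ^ 2 + (lam * snd Q - snd P) ^ 2 = (lam - 1) ^ 2 ->
  funk_dist P Q = ln lam.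
Proof.
intros HP HQ Hl HE.
destruct (Req_dec lam 1) as [->|Hne].
- rewrite ln_1.
  assert (HPQ : P = Q).
  { destruct P as [p1 p2], Q as [q1 q2]; simpl fst in HE; simpl snd in HE.
    destruct (sum_sqr_le0 (1 * q1 - p1) (1 * q2 - p2)) as [E1 E2]; [lra|]. f_equal; lra. }
  subst Q. apply real_glb_eq.
  + intros l (c & a & b & Hc & Hd & Ha & Hb & ->).
    (* For [e = 0] the bound says that lengths are nonnegative. *)
    destruct (piecewise_regular_length_ge c a b 0 0 ltac:(lra) Hc Hd) as [_ H].
    rewrite !Rmult_0_l, Rplus_0_r, Rminus_0_r, ln_1 in H. lra.
  + intros eps Heps. destruct (short_loop P eps HP Heps) as (c & a & b & Hc & Hd & Ha & Hb & Hlt).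
    exists (funk_length c a b). split; [|lra]. exists c, a, b; auto.
- assert (Hl1 : 1 < lam) by lra. apply real_glb_eq.
  + intros l (c & a & b & Hc & Hd & Ha & Hb & ->).
    (* The supporting line at the exit point [e] gives the sharp bound: [<e, lam Q - P> = lam - 1]
       means [1 - <e, P> = lam (1 - <e, Q>)]. *)
    pose (e1 := (lam * fst Q - fst P) / (lam - 1)).
    pose (e2 := (lam * snd Q - snd P) / (lam - 1)).
    assert (He : e1 ^ 2 + e2 ^ 2 = 1).
    { unfold e1, e2. rewrite sum_sqr_div, HE by lra. field; lra. }
    destruct (piecewise_regular_length_ge c a b e1 e2 ltac:(lra) Hc Hd) as [_ H].
    rewrite Ha, Hb in H.
    assert (Hq : 0 < 1 - (e1 * fst Q + e2 * snd Q))
      by (apply support_pos; [lra|apply unit_disk_iff; assumption]).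
    replace (1 - (e1 * fst P + e2 * snd P)) with (lam * (1 - (e1 * fst Q + e2 * snd Q))) in H.
    * rewrite ln_mult in H by lra. lra.
    * assert (e1 * (lam * fst Q - fst P) + e2 * (lam * snd Q - snd P) = lam - 1).
      { unfold e1, e2.
        replace (_ + _) with (((lam * fst Q - fst P) ^ 2 + (lam * snd Q - snd P) ^ 2) / (lam - 1))
          by (field; lra).
        rewrite HE; field; lra. }
      lra.
  + intros eps Heps.
    destruct (segment_length P Q lam HP HQ Hl1 HE) as (c & a & b & Hc & Hd & Ha & Hb & Hlen).
    exists (ln lam). split; [|lra]. exists c, a, b; auto.
Qed.

(** The equation for [lam] reads [A lam ^ 2 - 2 m lam + A' = 0], and [lam] is its larger root. The
    left side at [1] is [A + A' - 2 m = - |P - Q| ^ 2 <= 0], so this root is at least [1]. *)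
Lemma funk_dist_exists (P Q : R * R) :
  unit_disk P -> unit_disk Q ->
  exists lam, 1 <= lam /\
    (lam * fst Q - fst P) ^ 2 + (lam * snd Q - snd P) ^ 2 = (lam - 1) ^ 2 /\
    funk_dist P Q = ln lam.
Proof.
intros HP HQ. pose proof HP as HP'; pose proof HQ as HQ'.
rewrite unit_disk_iff in HP', HQ'.
destruct P as [p1 p2], Q as [q1 q2]; simpl fst in *; simpl snd in *.
pose (A := 1 - (q1 ^ 2 + q2 ^ 2)). pose (A' := 1 - (p1 ^ 2 + p2 ^ 2)).
pose (m := 1 - (p1 * q1 + p2 * q2)).
assert (HA : 0 < A) by (unfold A; lra).
assert (HA' : 0 < A') by (unfold A'; lra).
assert (Hm : A + A' <= 2 * m).
{ unfold A, A', m. pose proof (pow2_ge_0 (p1 - q1)). pose proof (pow2_ge_0 (p2 - q2)). nra. }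
assert (Hdisc : 0 <= m ^ 2 - A * A') by (pose proof (pow2_ge_0 (A - A')); nra).
pose proof (sqrt_pos (m ^ 2 - A * A')) as Hs.
pose proof (sqrt_sqrt _ Hdisc) as Hss.
set (s := sqrt (m ^ 2 - A * A')) in *.
assert (HmA : A <= m + s).
{ apply Rnot_lt_le; intros Hlt. nra. }
exists ((m + s) / A).
assert (H1 : 1 <= (m + s) / A).
{ apply (Rmult_le_reg_r A); [lra|]. unfold Rdiv; rewrite Rmult_assoc, Rinv_l; lra. }
assert (HE : ((m + s) / A * q1 - p1) ^ 2 + ((m + s) / A * q2 - p2) ^ 2 = ((m + s) / A - 1) ^ 2).
{ set (l := (m + s) / A).
  assert (Hl : A * l = m + s) by (unfold l; field; lra).
  assert (Hroot : A * (A * l ^ 2 - 2 * m * l + A') = 0).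
  { replace (A * (A * l ^ 2 - 2 * m * l + A')) with ((A * l - m) ^ 2 - (m ^ 2 - A * A')) by ring.
    rewrite <- Hss, Hl; ring. }
  apply Rmult_integral in Hroot; destruct Hroot as [?|Hroot]; [lra|].
  unfold A, A', m in Hroot. lra. }
split; [exact H1|]. split; [exact HE|].
apply funk_dist_eq; auto.
Qed.

(** * Distance to the directrix and the equation of the parabola *)

Lemma funk_dist_to_line (y0 eps : R) (P : R * R) :
  -1 < y0 < 1 -> eps = 1 \/ eps = -1 -> unit_disk P -> 0 <= eps * (y0 - snd P) ->
  funk_dist_to_set P (fun Q => unit_disk Q /\ snd Q = y0)
  = ln ((1 - eps * snd P) / (1 - eps * y0)).
Proof.
intros Hy Heps HP Hside.
pose proof HP as HP'; rewrite unit_disk_iff in HP'.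
destruct P as [p1 p2]; simpl fst in *; simpl snd in *.
assert (Hs : 0 < 1 - eps * y0) by (destruct Heps; subst; lra).
assert (Hp : 0 < 1 - eps * p2) by (destruct Heps; subst; nra).
set (lam := (1 - eps * p2) / (1 - eps * y0)).
assert (Hlam : lam * (1 - eps * y0) = 1 - eps * p2) by (unfold lam; field; lra).
assert (Hl1 : 1 <= lam) by nra.
apply real_glb_eq.
- intros l [Q [[HQ HQ2] ->]].
  destruct (funk_dist_exists (p1, p2) Q HP HQ) as [mu [Hmu [HE ->]]].
  rewrite HQ2 in HE; simpl fst in HE; simpl snd in HE.
  apply ln_le; [lra|].
  assert (H : 0 * (mu * fst Q - p1) + eps * (mu * y0 - p2) <= mu - 1)
    by (apply cauchy_schwarz2; [destruct Heps; subst; lra|lra|exact HE]).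
  apply (Rmult_le_reg_r (1 - eps * y0)); lra.
- intros e He. exists (ln lam); split; [|lra].
  assert (HE : lam * y0 - p2 = eps * (lam - 1)) by (destruct Heps; subst; lra).
  (* The nearest point is [P / lam + (1 - 1 / lam) e] with [e = (0, eps)]: the segment from [P] to
     [e] meets the directrix there. *)
  assert (HQ : unit_disk (p1 / lam, y0)).
  { apply unit_disk_iff; simpl fst; simpl snd.
    apply (Rmult_lt_reg_l (lam ^ 2)); [nra|].
    replace (lam ^ 2 * ((p1 / lam) ^ 2 + y0 ^ 2)) with (p1 ^ 2 + (lam * y0) ^ 2) by (field; lra).
    replace (lam * y0) with (p2 + eps * (lam - 1)) by lra.
    destruct Heps; subst eps; nra. }
  exists (p1 / lam, y0). split; [split; [exact HQ|reflexivity]|].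
  symmetry; apply funk_dist_eq; auto; simpl fst; simpl snd.
  rewrite HE. replace (lam * (p1 / lam) - p1) with 0 by (field; lra).
  destruct Heps; subst eps; ring.
Qed.

(* Both distances are [ln lam] for the same [lam]; the equation alone already
   forces [P] onto the side of the directrix containing the focus. *)
Lemma funk_parabola2_iff (y0 f0 g0 eps : R) (P : R * R) :
  -1 < y0 < 1 -> eps = 1 \/ eps = -1 -> unit_disk (f0, g0) -> 0 < eps * (y0 - g0) ->
  funk_parabola2 (fun Q => unit_disk Q /\ snd Q = y0) (f0, g0) P <->
  (let lam := (1 - eps * snd P) / (1 - eps * y0) in
   (lam * f0 - fst P) ^ 2 + (lam * g0 - snd P) ^ 2 = (lam - 1) ^ 2) /\ unit_disk P.
Proof.
intros Hy Heps HF Hh.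
destruct P as [x y]; simpl fst; simpl snd.
assert (Hs : 0 < 1 - eps * y0) by (destruct Heps; subst; lra).
set (lam := (1 - eps * y) / (1 - eps * y0)).
assert (Hlam : lam * (1 - eps * y0) = 1 - eps * y) by (unfold lam; field; lra).
unfold funk_parabola2. split.
- intros [HP HE]; split; [|exact HP].
  destruct (funk_dist_exists (x, y) (f0, g0) HP HF) as [mu [Hmu [Hc Hd]]].
  simpl fst in Hc; simpl snd in Hc.
  assert (Hy2 : y ^ 2 < 1) by (apply unit_disk_iff in HP; simpl fst in HP; simpl snd in HP; nra).
  destruct (Rle_dec 0 (eps * (y0 - y))) as [Hside|Hside].
  + rewrite Hd, (funk_dist_to_line y0 eps) in HE by auto.
    simpl snd in HE; fold lam in HE.
    assert (Hlp : 0 < lam).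
    { apply Rdiv_lt_0_compat; [|lra]. destruct Heps; subst; nra. }
    apply ln_inv in HE; [|lra|lra]. subst mu. exact Hc.
  (* Here the directrix separates [P] from the focus. The half-plane bound in the direction
     [(0, - eps)] makes the focus strictly farther from [P] than the line. *)
  + exfalso.
    rewrite Hd, (funk_dist_to_line y0 (- eps)) in HE; auto;
      [|destruct Heps; subst; lra|simpl snd; lra].
    simpl snd in HE.
    assert (Hs' : 0 < 1 - - eps * y0) by (destruct Heps; subst; lra).
    apply ln_inv in HE; [|lra|apply Rdiv_lt_0_compat; [destruct Heps; subst; nra|lra]].
    assert (Hmu' : mu * (1 - - eps * y0) = 1 - - eps * y) by (rewrite HE; field; lra).
    assert (H : 0 * (mu * f0 - x) + - eps * (mu * g0 - y) <= mu - 1)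
      by (apply cauchy_schwarz2; [destruct Heps; subst; lra|lra|exact Hc]).
    assert (mu * (eps * (y0 - g0)) <= 0) by lra. nra.
- intros [HE HP]; split; [exact HP|].
  assert (Hy2 : y ^ 2 < 1) by (apply unit_disk_iff in HP; simpl fst in HP; simpl snd in HP; nra).
  assert (Hlp : 0 < lam).
  { apply Rdiv_lt_0_compat; [|lra]. destruct Heps; subst; nra. }
  assert (Hl1 : 1 <= lam).
  (* For [lam < 1] the vector [lam F - P] would have norm [1 - lam], but its component along
     [(0, - eps)] is [1 - lam + lam * eps * (y0 - g0)], which is larger. *)
  { apply Rnot_lt_le; intros Hlt.
    assert (H : 0 * (lam * f0 - x) + - eps * (lam * g0 - y) <= 1 - lam)
      by (apply cauchy_schwarz2; [destruct Heps; subst; lra|lra|rewrite HE; ring]).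
    assert (lam * (eps * (y0 - g0)) <= 2 * (1 - lam)) by lra.
    assert (H' : 0 * (lam * f0 - x) + eps * (lam * g0 - y) <= 1 - lam)
      by (apply cauchy_schwarz2; [destruct Heps; subst; lra|lra|rewrite HE; ring]).
    nra. }
  rewrite (funk_dist_to_line y0 eps); auto; simpl snd; fold lam.
  + apply funk_dist_eq; auto.
  + nra.
Qed.

(** * Hyperbolas: from foci to quadratic equations *)

(** The focal equation with foci [f] and [- f] is squared twice. The second squaring is reversible
    because [U + G - 2 a ^ 2 >= 0] on the conic. *)
Lemma Rabs_dist_diff_iff (f1 f2 a u v : R) :
  0 < a -> a ^ 2 < f1 ^ 2 + f2 ^ 2 ->
  Rabs (sqrt ((u - f1) ^ 2 + (v - f2) ^ 2) - sqrt ((u + f1) ^ 2 + (v + f2) ^ 2)) = 2 * a <->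
  (f1 * u + f2 * v) ^ 2 - a ^ 2 * (u ^ 2 + v ^ 2) = a ^ 2 * (f1 ^ 2 + f2 ^ 2 - a ^ 2).
Proof.
intros Ha Hf.
assert (H1 : 0 <= (u - f1) ^ 2 + (v - f2) ^ 2)
  by (apply Rplus_le_le_0_compat; apply pow2_ge_0).
assert (H2 : 0 <= (u + f1) ^ 2 + (v + f2) ^ 2)
  by (apply Rplus_le_le_0_compat; apply pow2_ge_0).
pose proof (sqrt_pos ((u - f1) ^ 2 + (v - f2) ^ 2)) as P1.
pose proof (sqrt_pos ((u + f1) ^ 2 + (v + f2) ^ 2)) as P2.
pose proof (sqrt_sqrt _ H1) as S1. pose proof (sqrt_sqrt _ H2) as S2.
set (d1 := sqrt ((u - f1) ^ 2 + (v - f2) ^ 2)) in *.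
set (d2 := sqrt ((u + f1) ^ 2 + (v + f2) ^ 2)) in *.
set (w := f1 * u + f2 * v). set (U := u ^ 2 + v ^ 2). set (G := f1 ^ 2 + f2 ^ 2) in *.
assert (T1 : d1 * d1 = U + G - 2 * w) by (rewrite S1; unfold U, G, w; ring).
assert (T2 : d2 * d2 = U + G + 2 * w) by (rewrite S2; unfold U, G, w; ring).
assert (Hprod : (d1 * d2) ^ 2 = (U + G) ^ 2 - 4 * w ^ 2).
{ replace ((d1 * d2) ^ 2) with ((d1 * d1) * (d2 * d2)) by ring. rewrite T1, T2; ring. }
split; intros H.
- assert (Hsq : (d1 - d2) ^ 2 = (2 * a) ^ 2) by (rewrite <- H, pow2_abs; ring).
  assert (Hdd : d1 * d2 = U + G - 2 * a ^ 2) by nra.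
  rewrite Hdd in Hprod. lra.
(* Combining [w ^ 2 <= U G] with the equation gives [(U - a ^ 2) (G - a ^ 2) >= 0]. *)
- assert (HU : a ^ 2 <= U).
  { assert (Hcs : w ^ 2 <= U * G).
    { pose proof (pow2_ge_0 (f1 * v - f2 * u)). unfold w, U, G. nra. }
    apply Rnot_lt_le; intros Hlt. nra. }
  assert (Hdd : d1 * d2 = U + G - 2 * a ^ 2).
  { apply Rsqr_inj; [apply Rmult_le_pos; assumption|lra|]. rewrite !Rsqr_pow2, Hprod. lra. }
  apply Rsqr_inj; [apply Rabs_pos|lra|].
  rewrite <- Rsqr_abs, !Rsqr_pow2.
  replace ((d1 - d2) ^ 2) with (d1 * d1 + d2 * d2 - 2 * (d1 * d2)) by ring.
  rewrite T1, T2, Hdd; ring.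
Qed.

(** This factors the singular positive semidefinite matrix [[[s, q], [q, t]]] as [f f^T]; the second
    component carries the sign of [q]. *)
Lemma square_root_pair (s t q : R) :
  0 <= s -> 0 <= t -> s * t = q ^ 2 ->
  exists f1 f2, f1 ^ 2 = s /\ f2 ^ 2 = t /\ f1 * f2 = q.
Proof.
intros Hs Ht H.
assert (E : sqrt s * sqrt t = Rabs q).
{ rewrite <- sqrt_mult, H by assumption. rewrite <- Rsqr_pow2. apply sqrt_Rsqr_abs. }
destruct (Rle_dec 0 q) as [Hq|Hq].
- exists (sqrt s), (sqrt t). rewrite E, !pow2_sqrt, Rabs_pos_eq; auto.
- exists (sqrt s), (- sqrt t).
  replace ((- sqrt t) ^ 2) with (sqrt t ^ 2) by ring.
  rewrite !pow2_sqrt, <- Ropp_mult_distr_r, E, Rabs_left by lra. repeat split; lra.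
Qed.

(* With [N = [[p, q], [q, r]]] and [- a ^ 2] its negative eigenvalue, [N + a ^ 2 I]
   is positive semidefinite of rank one, hence equal to [f f^T]; then
   [center + f] and [center - f] are the foci. *)
Lemma euclidean_hyperbola_centered (p q r xc yc : R) :
  p * r - q ^ 2 < 0 ->
  euclidean_hyperbola (fun P =>
    p * (fst P - xc) ^ 2 + 2 * q * (fst P - xc) * (snd P - yc) + r * (snd P - yc) ^ 2
    = q ^ 2 - p * r).
Proof.
intros Hdet.
assert (HS0 : 0 <= (p - r) ^ 2 + 4 * q ^ 2)
  by (pose proof (pow2_ge_0 (p - r)); pose proof (pow2_ge_0 q); lra).
pose proof (sqrt_pos ((p - r) ^ 2 + 4 * q ^ 2)) as HSp.
pose proof (sqrt_sqrt _ HS0) as HSS.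
set (S := sqrt ((p - r) ^ 2 + 4 * q ^ 2)) in *.
(* [- m] is the smaller eigenvalue of [N], and [a = sqrt m]. Then [|f| ^ 2 = p + r + 2 m = S], so [a
   ^ 2 (|f| ^ 2 - a ^ 2) = m (m + p + r) = q ^ 2 - p r], the constant in the equation. *)
pose (m := (S - (p + r)) / 2).
assert (HS : S = 2 * m + (p + r)) by (unfold m; field).
assert (Hchar : m ^ 2 + (p + r) * m + (p * r - q ^ 2) = 0) by (rewrite HS in HSS; nra).
assert (Hm : 0 < m) by (unfold m; apply Rnot_le_lt; intros Hle; nra).
assert (Hn : 0 < m + (p + r)) by nra.
assert (Hpm : 0 <= p + m).
{ apply Rnot_lt_le; intros Hlt. assert (S < r - p) by lra. pose proof (pow2_ge_0 q). nra. }
assert (Hrm : 0 <= r + m).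
{ apply Rnot_lt_le; intros Hlt. assert (S < p - r) by lra. pose proof (pow2_ge_0 q). nra. }
destruct (square_root_pair (p + m) (r + m) q Hpm Hrm) as (f1 & f2 & Hf1 & Hf2 & Hf12); [lra|].
assert (Ha : 0 < sqrt m) by (apply sqrt_lt_R0; lra).
assert (Ham : sqrt m ^ 2 = m) by (apply pow2_sqrt; lra).
exists (xc + f1, yc + f2), (xc - f1, yc - f2), (sqrt m).
split; [exact Ha|]. split.
- unfold edist, dist_euc; simpl fst; simpl snd.
  rewrite !Rsqr_pow2.
  replace ((xc + f1 - (xc - f1)) ^ 2 + (yc + f2 - (yc - f2)) ^ 2)
    with (2 ^ 2 * S) by (rewrite HS; lra).
  replace (2 * sqrt m) with (sqrt (2 ^ 2 * m)).
  + apply sqrt_lt_1; lra.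
  + rewrite sqrt_mult, sqrt_pow2 by lra. reflexivity.
- intros [x y]; unfold edist, dist_euc; simpl fst; simpl snd.
  rewrite !Rsqr_pow2.
  replace (x - (xc + f1)) with (x - xc - f1) by ring.
  replace (y - (yc + f2)) with (y - yc - f2) by ring.
  replace (x - (xc - f1)) with (x - xc + f1) by ring.
  replace (y - (yc - f2)) with (y - yc + f2) by ring.
  rewrite Rabs_dist_diff_iff by lra.
  set (u := x - xc). set (v := y - yc).
  replace ((f1 * u + f2 * v) ^ 2) with (f1 ^ 2 * u ^ 2 + 2 * (f1 * f2) * u * v + f2 ^ 2 * v ^ 2)
    by ring.
  rewrite Ham, Hf1, Hf2, Hf12. split; intros H; lra.
Qed.

Lemma euclidean_hyperbola_ext (H K : R * R -> Prop) :
  (forall P, H P <-> K P) -> euclidean_hyperbola H -> euclidean_hyperbola K.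
Proof.
intros HK (F1 & F2 & a & Ha & Hf & E). exists F1, F2, a; repeat split; auto.
- intros KP; apply E, HK, KP.
- intros EP; apply HK, E, EP.
Qed.

(** * The conic of the theorem and its arc in the disk *)

(* The curve in the affine coordinates [x] and [ybar = 1 - eps * y]. *)
Definition conic (B C E eps : R) (P : R * R) : Prop :=
  fst P ^ 2 + B * fst P * (1 - eps * snd P) + C * (1 - eps * snd P) ^ 2
    + E * (1 - eps * snd P) = 0.

Lemma conic_hyperbola (B C E eps : R) :
  eps = 1 \/ eps = -1 -> E <> 0 -> 0 < B ^ 2 - 4 * C ->
  euclidean_hyperbola (conic B C E eps).
Proof.
intros Heps HE HD. set (D := B ^ 2 - 4 * C) in *.
(* In the coordinates [(x, ybar)] the centre is [(- B E / D, 2 E / D)], where the conic polynomial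
   equals [E ^ 2 / D]. The factor [k] rescales the equation so that its constant becomes minus the
   determinant, [k ^ 2 D / 4]. *)
pose (k := - (4 * E ^ 2 / D ^ 2)).
assert (Hk : k <> 0).
{ unfold k. apply Ropp_neq_0_compat, Rmult_integral_contrapositive_currified;
    [apply Rmult_integral_contrapositive_currified; [lra|apply pow_nonzero; lra]
    |apply Rinv_neq_0_compat, pow_nonzero; lra]. }
assert (Hee : eps ^ 2 = 1) by (destruct Heps; subst; ring).
apply (euclidean_hyperbola_ext (fun P =>
    k * (fst P - (- (B * E / D))) ^ 2
    + 2 * (- (k * eps * B / 2)) * (fst P - (- (B * E / D))) * (snd P - eps * (1 - 2 * E / D))
    + k * C * (snd P - eps * (1 - 2 * E / D)) ^ 2
    = (- (k * eps * B / 2)) ^ 2 - k * (k * C))).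
2: { apply euclidean_hyperbola_centered.
  assert (H : k * (k * C) - (- (k * eps * B / 2)) ^ 2 = - (k ^ 2 * D / 4)).
  { unfold D. replace ((- (k * eps * B / 2)) ^ 2) with (k ^ 2 * B ^ 2 / 4 * eps ^ 2) by field.
    rewrite Hee; field. }
  rewrite H. assert (0 < k ^ 2) by (apply pow2_gt_0; exact Hk). nra. }
intros [x y]; unfold conic; simpl fst; simpl snd.
assert (Hid : k * (x - (- (B * E / D))) ^ 2
    + 2 * (- (k * eps * B / 2)) * (x - (- (B * E / D))) * (y - eps * (1 - 2 * E / D))
    + k * C * (y - eps * (1 - 2 * E / D)) ^ 2
    - ((- (k * eps * B / 2)) ^ 2 - k * (k * C))
  = k * (x ^ 2 + B * x * (1 - eps * y) + C * (1 - eps * y) ^ 2 + E * (1 - eps * y))).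
{ replace C with ((B ^ 2 - D) / 4) by (unfold D; field).
  unfold k. clearbody D. destruct Heps; subst eps; field; lra. }
split; intros H.
- assert (Hz : k * (x ^ 2 + B * x * (1 - eps * y) + C * (1 - eps * y) ^ 2 + E * (1 - eps * y)) = 0)
    by lra.
  apply Rmult_integral in Hz; destruct Hz; [contradiction|assumption].
- rewrite H in Hid. lra.
Qed.

(* The hypothesis says that the quadratic [(E + 2) t ^ 2 + 2 B t + (E + 2 C)],
   which is negative exactly when the point of parameter [t] is in the disk,
   has positive discriminant. *)
Lemma conic_disk_convex (B C E eps : R) :
  eps = 1 \/ eps = -1 -> 0 < E -> (E + 2) * (E + 2 * C) < B ^ 2 ->
  convex_curve (fun P => conic B C E eps P /\ unit_disk P).
Proof.
intros Heps HE HD.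
assert (Hee : eps ^ 2 = 1) by (destruct Heps; subst; ring).
(* Lines [x = t * ybar] through the point [(0, eps)] of the conic meet it in one
   further point, with [ybar = E / q t]. *)
pose (q := fun t : R => - (t ^ 2 + B * t + C)).
(* With [z = 1 - eps * y] the disk is [x ^ 2 + z ^ 2 < 2 z]; substituting [x = t z] and
   [z = E / q t] gives this condition. *)
pose (J := fun t : R => E * (t ^ 2 + 1) < 2 * q t).
assert (Hq : forall t, J t -> 0 < q t) by (unfold J; intros t Ht; nra).
pose (c1 := fun t : R => E * t / q t).
pose (c2 := fun t : R => eps * (1 - E / q t)).
pose (d1 := fun t : R => E * (q t + t * (2 * t + B)) / q t ^ 2).
pose (d2 := fun t : R => - eps * E * (2 * t + B) / q t ^ 2).
assert (Hder : forall t, q t <> 0 -> is_derive c1 t (d1 t) /\ is_derive c2 t (d2 t)).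
{ intros t Ht; unfold c1, c2, d1, d2, q in *; split; auto_derive; auto; field; lra. }
assert (Hbar : forall t, 1 - eps * c2 t = E / q t).
{ intros t; unfold c2. replace (1 - eps * (eps * (1 - E / q t)))
    with (1 - eps ^ 2 * (1 - E / q t)) by ring. rewrite Hee; ring. }
assert (Htrace : forall P, conic B C E eps P /\ unit_disk P <-> exists t, J t /\ (c1 t, c2 t) = P).
{ intros [x y]; rewrite unit_disk_iff; unfold conic; simpl fst; simpl snd. split.
  - intros [Hc Hd]. set (z := 1 - eps * y) in *.
    assert (Hy : y = eps * (1 - z))
      by (unfold z; replace (eps * (1 - (1 - eps * y))) with (eps ^ 2 * y) by ring; rewrite Hee; ring).
    assert (Hd' : x ^ 2 + z ^ 2 < 2 * z).
    { rewrite Hy in Hd. replace ((eps * (1 - z)) ^ 2) with (eps ^ 2 * (1 - z) ^ 2) in Hd by ring.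
      rewrite Hee in Hd. lra. }
    assert (Hz : 0 < z) by nra.
    assert (Hqz : q (x / z) = E / z).
    { unfold q. apply (Rmult_eq_reg_r (z ^ 2)); [|nra].
      replace (E / z * z ^ 2) with (E * z) by (field; lra).
      replace (- ((x / z) ^ 2 + B * (x / z) + C) * z ^ 2)
        with (- (x ^ 2 + B * x * z + C * z ^ 2)) by (field; lra). lra. }
    exists (x / z). split.
    + unfold J; rewrite Hqz. apply (Rmult_lt_reg_r (z ^ 2)); [nra|].
      replace (E * ((x / z) ^ 2 + 1) * z ^ 2) with (E * (x ^ 2 + z ^ 2)) by (field; lra).
      replace (2 * (E / z) * z ^ 2) with (E * (2 * z)) by (field; lra).
      apply Rmult_lt_compat_l; assumption.
    + unfold c1, c2; rewrite Hqz, Hy. f_equal; field; lra.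
  - intros [t [Jt Heq]]. injection Heq as <- <-. specialize (Hq t Jt). rewrite Hbar. split.
    + assert (HqE : t ^ 2 + B * t + C = - q t) by (unfold q; ring).
      unfold c1. replace (_ + _ + _ + _) with ((E / q t) ^ 2 * (t ^ 2 + B * t + C + q t))
        by (field; lra).
      rewrite HqE; ring.
    + unfold c1, c2. replace ((eps * (1 - E / q t)) ^ 2) with (eps ^ 2 * (1 - E / q t) ^ 2) by ring.
      rewrite Hee.
      assert (Hneg : E / q t ^ 2 * (E * (t ^ 2 + 1) - 2 * q t) < 0).
      { unfold J in Jt. assert (0 < E / q t ^ 2) by (apply Rdiv_lt_0_compat; nra). nra. }
      replace ((E * t / q t) ^ 2 + 1 * (1 - E / q t) ^ 2)
        with (1 + E / q t ^ 2 * (E * (t ^ 2 + 1) - 2 * q t)) by (field; lra).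
      lra. }
exists J, (fun t => (c1 t, c2 t)). split; [|split; [|split; [|split]]].
(* Completing the square in the quadratic defining [J] gives [A d ^ 2 - v] at [- B / A + d]; it is
   negative at [d = 0] and at [d = sqrt (v / (2 A))]. *)
- set (A := E + 2). set (v := B ^ 2 / A - (E + 2 * C)).
  assert (HA : 0 < A) by (unfold A; lra).
  assert (Hv : 0 < v).
  { unfold v. apply (Rmult_lt_reg_r A); [lra|].
    replace ((B ^ 2 / A - (E + 2 * C)) * A) with (B ^ 2 - A * (E + 2 * C)) by (field; lra).
    unfold A; lra. }
  assert (Hquad : forall d, E * ((- B / A + d) ^ 2 + 1) - 2 * q (- B / A + d) = A * d ^ 2 - v).
  { intros d; unfold q, v. replace E with (A - 2) by (unfold A; ring). field; lra. }
  exists (- B / A + 0), (- B / A + sqrt (v / (2 * A))).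
  pose proof (Hquad 0) as Q0. pose proof (Hquad (sqrt (v / (2 * A)))) as Q1.
  rewrite pow2_sqrt in Q1 by (apply Rlt_le, Rdiv_lt_0_compat; lra).
  replace (A * (v / (2 * A)) - v) with (- (v / 2)) in Q1 by (field; lra).
  unfold J. repeat split; try lra.
  apply Rplus_lt_compat_l, sqrt_lt_R0, Rdiv_lt_0_compat; lra.
- intros t u v Jt Jv Hu. unfold J, q in *.
  assert ((E + 2) * ((u - t) * (v - u)) >= 0)
    by (apply Rle_ge, Rmult_le_pos; [lra|apply Rmult_le_pos; lra]).
  set (g := fun s : R => E * (s ^ 2 + 1) - 2 * - (s ^ 2 + B * s + C)).
  (* A quadratic with leading coefficient [E + 2 > 0] lies below its chord, so negativity at the
     ends passes to the points between. *)
  assert (Hg : (v - t) * g u = (v - u) * g t + (u - t) * g v - (v - t) * ((E + 2) * ((u - t) * (v - u))))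
    by (unfold g; ring).
  assert (g t < 0) by (unfold g; lra). assert (g v < 0) by (unfold g; lra).
  cut (g u < 0); [unfold g; lra|].
  destruct (Req_dec u t) as [->|Hut]; [assumption|]. nra.
- apply (regular_on_pair _ _ _ d1 d2).
  + intros t Jt. specialize (Hq t Jt).
    assert (L : locally t (fun u => 0 < q u)).
    { apply (open_gt 0 (q t)) in Hq.
      assert (Cq : continuous q t)
        by (apply (@ex_derive_continuous R_AbsRing R_NormedModule); unfold q; auto_derive; trivial).
      apply Cq, Hq. }
    revert L; apply filter_imp; intros u Hu; apply Hder; lra.
  + intros t Jt. specialize (Hq t Jt).
    split; apply (@ex_derive_continuous R_AbsRing R_NormedModule);
      unfold d1, d2, q in *; auto_derive; apply Rgt_not_eq; nra.
  + intros t Jt. specialize (Hq t Jt). apply Rnot_le_lt; intros Hle.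
    destruct (sum_sqr_le0 _ _ Hle) as [E1 E2].
    (* Vanishing of [d2] forces [2 t + B = 0], which leaves [d1 = E / q t], a nonzero number. *)
    assert (Hb : 2 * t + B = 0).
    { replace (2 * t + B) with (- d2 t * eps * q t ^ 2 / E).
      - rewrite E2; field; lra.
      - unfold d2. transitivity (eps ^ 2 * (2 * t + B)); [field; lra|rewrite Hee; ring]. }
    unfold d1 in E1. rewrite Hb in E1.
    assert (E = E * (q t + t * 0) / q t ^ 2 * q t) by (field; lra).
    rewrite E1 in H; lra.
- exact Htrace.
- intros t Jt. pose proof (Hq t Jt) as Hqt.
  destruct (Hder t ltac:(lra)) as [D1 D2].
  rewrite (velocity_pair c1 c2 t _ _ D1 D2).
  (* Relative to the tangent at [t], the determinant at the point of parameter [u] is [- eps] times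
     a square over positive factors, so its sign depends on [eps] alone. *)
  assert (Hdet : forall P, conic B C E eps P /\ unit_disk P ->
     exists k, 0 <= k /\ det2 (d1 t, d2 t) (vsub P (c1 t, c2 t)) = - eps * k).
  { intros P HP. apply Htrace in HP. destruct HP as [u [Ju <-]].
    pose proof (Hq u Ju) as Hqu.
    exists (E ^ 2 * (u - t) ^ 2 / (q t ^ 2 * q u)). split.
    - apply Rdiv_le_0_compat; [|apply Rmult_lt_0_compat; nra].
      apply Rmult_le_pos; apply pow2_ge_0.
    - unfold det2, vsub, d1, d2, c1, c2; simpl fst; simpl snd.
      assert (Hqq : q u = q t - (2 * t + B) * (u - t) - (u - t) ^ 2) by (unfold q; ring).
      rewrite Hqq in *. clearbody q. field; lra. }
  destruct Heps; subst eps.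
  + right; intros P HP; destruct (Hdet P HP) as [k [Hk ->]]; lra.
  + left; intros P HP; destruct (Hdet P HP) as [k [Hk ->]]; lra.
Qed.

(** * Identification of the parabola with the conic *)

Theorem proposition3p3 (y0 f0 g0 : R)
  (hy0 : -1 < y0 < 1) (hF : unit_disk (f0, g0)) (hg : g0 <> y0) :
  let s : R * R -> Prop := fun P => unit_disk P /\ snd P = y0 in
  let sigma2 := 1 - sign (y0 - g0) * y0 in
  let B := - (2 * f0 / sigma2) in
  let C := (f0 ^ 2 + (y0 - g0) ^ 2 - 2 * Rabs (y0 - g0)) / sigma2 ^ 2 in
  let E := 2 * Rabs (y0 - g0) / sigma2 in
  let H : R * R -> Prop := fun P =>
    let x := fst P in
    let ybar := 1 - sign (y0 - g0) * snd P in
    x ^ 2 + B * x * ybar + C * ybar ^ 2 + E * ybar = 0 in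
  euclidean_hyperbola H /\
  (forall P, funk_parabola2 s (f0, g0) P <-> H P /\ unit_disk P) /\
  convex_curve (fun P => H P /\ unit_disk P).
Proof.
intros s sigma2 B C E H.
assert (Heps : (sign (y0 - g0) = 1 \/ sign (y0 - g0) = -1) /\
               Rabs (y0 - g0) = sign (y0 - g0) * (y0 - g0)).
{ destruct (Rlt_le_dec g0 y0).
  - rewrite sign_eq_1, Rabs_pos_eq by lra. lra.
  - rewrite sign_eq_m1, Rabs_left by lra. lra. }
destruct Heps as [Heps Habs].
assert (Hh : 0 < Rabs (y0 - g0)) by (apply Rabs_pos_lt; lra).
set (eps := sign (y0 - g0)) in *. set (h := Rabs (y0 - g0)) in *.
assert (Hee : eps ^ 2 = 1) by (destruct Heps as [->| ->]; ring).
assert (Hs : 0 < sigma2) by (unfold sigma2; destruct Heps as [->| ->]; lra).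
assert (Hg : eps * g0 = 1 - sigma2 - h) by (unfold sigma2; lra).
assert (Hsq : (y0 - g0) ^ 2 = h ^ 2).
{ rewrite Habs, Rpow_mult_distr, Hee; ring. }
(* Membership of the focus in the disk, in terms of [sigma2] and [h]; it also yields
   [sigma2 + h < 2], hence [h < 2]. *)
assert (HF : f0 ^ 2 + (1 - sigma2 - h) ^ 2 < 1).
{ rewrite <- Hg, Rpow_mult_distr, Hee, Rmult_1_l. apply unit_disk_iff in hF; exact hF. }
assert (HE : 0 < E) by (unfold E; apply Rdiv_lt_0_compat; lra).
change H with (conic B C E eps).
split; [|split].
- apply conic_hyperbola; [assumption|lra|].
  replace (B ^ 2 - 4 * C) with (4 * h * (2 - h) / sigma2 ^ 2)
    by (unfold B, C; rewrite Hsq; field; lra).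
  apply Rdiv_lt_0_compat; nra.
- intros P. unfold s. rewrite (funk_parabola2_iff y0 f0 g0 eps) by (try assumption; lra).
  cbv zeta. fold sigma2.
  set (lam := (1 - eps * snd P) / sigma2).
  assert (Hlam : 1 - eps * snd P = lam * sigma2) by (unfold lam; field; lra).
  assert (Hid : (lam * f0 - fst P) ^ 2 + (lam * g0 - snd P) ^ 2 - (lam - 1) ^ 2 =
    fst P ^ 2 + B * fst P * (1 - eps * snd P) + C * (1 - eps * snd P) ^ 2
      + E * (1 - eps * snd P)).
  { replace ((lam * g0 - snd P) ^ 2) with ((lam * (eps * g0) - eps * snd P) ^ 2)
      by (transitivity (eps ^ 2 * (lam * g0 - snd P) ^ 2); [ring|rewrite Hee; ring]).
    replace (eps * snd P) with (1 - lam * sigma2) by lra.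
    rewrite Hg. unfold B, C, E. rewrite Hsq. field; lra. }
  unfold conic. rewrite <- Hid. split; intros [H1 H2]; split; auto; lra.
- apply conic_disk_convex; auto.
  apply Rlt_0_minus.
  (* The factor [(sigma2 + h) (2 - (sigma2 + h)) - f0 ^ 2] is [1 - f0 ^ 2 - g0 ^ 2], positive
     because the focus is in the disk. *)
  replace (B ^ 2 - (E + 2) * (E + 2 * C))
    with (4 * h * ((sigma2 + h) * (2 - (sigma2 + h)) - f0 ^ 2) / sigma2 ^ 3)
    by (unfold B, C, E; rewrite Hsq; field; lra).
  apply Rdiv_lt_0_compat; [|apply pow_lt; lra].
  apply Rmult_lt_0_compat; lra.
Qed.
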